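(* Algorithm 2 (described in the context) is a 4-approximation algorithm for min-max 2-TSP: for every instance, the returned tours $C_b,C_r$ satisfy $\max\{c(C_b),c(C_r)\}\le 4\cdot\mathrm{OPT}_{mm}$, where $\mathrm{OPT}_{mm}$ is the minimum of $\max\{c(R),c(B)\}$ over all feasible solutions.
   Context: An instance of 2-TSP consists of $2n$ nodes $V$ (with $n$ even) partitioned into $n$ pairs $\{p_i,q_i\}$, with metric edge weights $c$ on the complete graph on $V$ (nonnegative, triangle inequality). A feasible solution colors one node of each pair red and the other blue, and consists of a tour (Hamiltonian cycle) $R$ on the red nodes and a tour $B$ on the blue nodes; the min-max objective minimizes $\max\{c(R),c(B)\}$, with $c(F)$ the total weight of edge set $F$. Algorithm 2: (1) compute a minimum spanning tree $T$ on all $2n$ nodes; (2) delete a maximum-weight edge $e_\times$ of $T$, obtaining trees $T_L,T_R$ on node sets $V_L,V_R$; (3) for each pair with one node in $V_L$ and the other in $V_R$, color the node in $V_L$ blue and the node in $V_R$ red; (4) for every other pair, assign its nodes arbitrary distinct colors; (5) compute a tour $C$ of all nodes from $T$ by edge-doubling (Eulerian circuit of the doubled tree, shortcutting repeated nodes); (6) for each color $c\in\{b,r\}$, let $C_c$ be the tour of the color-$c$ nodes obtained by shortcutting $C$; return $\{C_b,C_r\}$. *)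

(* Defs.v *)
From HB Require Import structures.
From mathcomp Require Import all_boot all_order all_algebra.
Set Implicit Arguments.
Unset Strict Implicit.
Unset Printing Implicit Defensive.
Import Order.TTheory GRing.Theory Num.Theory.
Local Open Scope ring_scope.

(* Edges of the complete graph on V are the two-element sets [set x; y]. *)

Section Graphs.
Variable V : finType.
Implicit Types (T : {set {set V}}) (s w C : seq V) (x y : V).

Definition adj T : rel V := fun x y => (x != y) && ([set x; y] \in T).

Definition simple_graph T : bool := [forall e in T, #|e| == 2].

Definition spanning_tree T : Prop :=
  [/\ simple_graph T,
      forall x y, connect (adj T) x y
    & forall s, ucycle (adj T) s -> (size s < 3)%N].

Definition component T x : {set V} := [set y | connect (adj T) x y].

(* A closed walk is given by the list of its successive nodes, the last one
   being followed by the first; the edges are listed with multiplicity, so a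
   tour on two nodes traverses its edge twice. *)
Definition walk_edges w : seq {set V} :=
  [seq [set a.1; a.2] | a <- zip w (rot 1 w)].

(* An Eulerian circuit of the multigraph with two copies of each edge of T. *)
Definition doubled_euler_circuit T w : bool :=
  perm_eq (walk_edges w) (enum T ++ enum T).

Definition tour_on (A : {set V}) s : bool := perm_eq s (enum A).

(* Any choice of the occurrence kept for each node is allowed. *)
Definition shortcut_tour w C : bool := tour_on [set: V] C && subseq C w.

End Graphs.

Section Weights.
Variables (R : realFieldType) (V : finType).
Implicit Types (c : {set V} -> R) (T : {set {set V}}).

Definition metric c : Prop :=
  (forall x y, x != y -> 0 <= c [set x; y]) /\
  (forall x y z, x != y -> y != z -> x != z ->
     c [set x; z] <= c [set x; y] + c [set y; z]).

Definition tour_weight c (s : seq V) : R := \sum_(e <- walk_edges s) c e.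

Definition tree_weight c T : R := \sum_(e in T) c e.

Definition min_spanning_tree c T : Prop :=
  spanning_tree T /\
  forall T', spanning_tree T' -> tree_weight c T <= tree_weight c T'.

End Weights.

Section TwoTSP.
Variables (R : realFieldType) (n : nat) (V : finType).
Implicit Types (p q : 'I_n -> V) (c : {set V} -> R) (red : {set V}).
Implicit Types (r b : seq V).

(* The p_i and q_i enumerate the 2n nodes of V without repetition. *)
Definition pairing p q : Prop :=
  bijective (fun u : 'I_n * bool => if u.2 then q u.1 else p u.1).

(* The blue nodes are those outside red. *)
Definition coloring p q red : bool :=
  [forall i, (p i \in red) != (q i \in red)].

Definition feasible p q red r b : bool :=
  [&& coloring p q red, tour_on red r & tour_on (~: red) b].

Definition mm_cost c r b : R := Num.max (tour_weight c r) (tour_weight c b).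

Definition solution : Type := ({set V} * n.-tuple V * n.-tuple V)%type.

(* The minimum over the finite, nonempty set of feasible solutions; the seed
   of the arg min is the solution in which every p_i is red. See opt_mmP. *)
Definition opt_mm c p q : R :=
  let s0 : solution := ([set p i | i : 'I_n], [tuple p i | i < n],
                        [tuple q i | i < n]) in
  let s := [arg min_(s < s0 | feasible p q s.1.1 s.1.2 s.2)
              mm_cost c s.1.2 s.2]%O in
  mm_cost c s.1.2 s.2.

(* algorithm2 c p q red Cr Cb: some execution of the algorithm colors the
   nodes of red red, the others blue, and returns the tours Cr and Cb. All
   arbitrary choices, including which side of the deleted edge [set xL; xR] is
   the left one, are left open. *)
Inductive algorithm2 c p q : {set V} -> seq V -> seq V -> Prop :=
| Algorithm2_run (T : {set {set V}}) (xL xR : V) red (w C : seq V) of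
    min_spanning_tree c T
  & [set xL; xR] \in T
  & (forall e, e \in T -> c e <= c [set xL; xR])
  & coloring p q red
  & (forall i x y, [set x; y] = [set p i; q i] ->
       x \in component (T :\ [set xL; xR]) xL ->
       y \in component (T :\ [set xL; xR]) xR ->
       x \notin red /\ y \in red)
  & doubled_euler_circuit T w
  & shortcut_tour w C :
  algorithm2 c p q red [seq x <- C | x \in red] [seq x <- C | x \notin red].

Lemma card_coloring p q red :
  pairing p q -> coloring p q red -> #|red| = n /\ #|~: red| = n.
Proof.
move=> pq /forallP col.
have half (A : {set V}) : (forall i, (p i \in A) != (q i \in A)) -> #|A| = n.
  move=> colA; rewrite -sum1_card big_mkcond /=.
  rewrite (reindex _ (onW_bij _ pq)) /=.
  rewrite -(pair_bigA _ (fun i d =>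
    if (if d then q i else p i) \in A then 1%N else 0%N)) /=.
  rewrite -[RHS]card_ord -sum1_card; apply: eq_bigr => i _.
  by rewrite big_bool /=; move: (colA i); do 2!case: (_ \in A).
split; apply: half => // i.
by rewrite !inE; move: (col i); do 2!case: (_ \in red).
Qed.

Lemma opt_mmP c p q : pairing p q ->
  (exists red r b, feasible p q red r b /\ mm_cost c r b = opt_mm c p q) /\
  (forall red r b, feasible p q red r b -> opt_mm c p q <= mm_cost c r b).
Proof.
move=> pq; have inj := bij_inj pq.
have injp : injective p by move=> i j e; case: (inj (i, false) (j, false) e).
have injq : injective q by move=> i j e; case: (inj (i, true) (j, true) e).
have pNq i j : p i != q j.
  by apply/eqP => e; have := inj (i, false) (j, true) e.
have sur x : (x \in [set p i | i : 'I_n]) || (x \in [set q i | i : 'I_n]).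
  have [g _ gK] := pq; rewrite -(gK x).
  by case: (g x) => i [] /=; rewrite !imset_f ?orbT.
have pr i : p i \in [set p j | j : 'I_n] by rewrite imset_f.
have qr i : q i \notin [set p j | j : 'I_n].
  by apply/imsetP => -[j _ e]; have := pNq j i; rewrite e eqxx.
have mt (f : 'I_n -> V) x :
    (x \in [tuple f i | i < n]) = (x \in [set f i | i : 'I_n]).
  apply/mapP/imsetP => -[i _ ->]; exists i => //.
  by rewrite val_ord_tuple mem_enum.
have ut (f : 'I_n -> V) : injective f -> uniq [tuple f i | i < n].
  by move=> fi; rewrite map_inj_uniq // val_ord_tuple enum_uniq.
have feas0 : feasible p q [set p i | i : 'I_n] [tuple p i | i < n]
    [tuple q i | i < n].
  apply/and3P; split.
  - by apply/forallP => i; rewrite pr (negbTE (qr i)).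
  - apply: uniq_perm; [exact: ut | exact: enum_uniq |].
    by move=> x; rewrite mem_enum mt.
  - apply: uniq_perm; [exact: ut | exact: enum_uniq |].
    move=> x; rewrite mem_enum mt inE; have := sur x.
    case: (boolP (x \in [set q i | i : 'I_n])) => [/imsetP[i _ ->]|_].
      by rewrite qr.
    by rewrite orbF => ->.
rewrite /opt_mm; case: arg_minP => //= [[[red r] b]] /= feas min.
split; first by exists red, r, b.
move=> red' r' b' F; have /and3P[col tr tb] := F.
have [cr cb] := card_coloring pq col.
have sr : size r' == n by rewrite (perm_size tr) -cardE cr.
have sb : size b' == n by rewrite (perm_size tb) -cardE cb.
exact: (min (red', Tuple sr, Tuple sb)).
Qed.

End TwoTSP.

(* Main.v *)
(* Let f be the deleted edge of the tree T and let r, b be optimal tours.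
   Shortening r and b to paths and joining them by an edge of T gives a
   connected graph, so c(T) - c(f) <= c(r) + c(b). If r or b crosses the cut
   defined by f, the edge dropped from it may be chosen in the cut, where it
   costs at least c(f), so even c(T) <= c(r) + c(b), and shortcutting the doubled
   tree costs at most 2 c(T). Otherwise r and b are the two sides of the cut,
   every pair is split, the algorithm colors the sides monochromatically, and
   its tours need not pay for f: they cost at most 2 (c(T) - c(f)). *)

Require Import Defs.
From HB Require Import structures.
From mathcomp Require Import all_boot all_order all_algebra.
From mathcomp Require Import lra.
Import Order.TTheory GRing.Theory Num.Theory.
Local Open Scope ring_scope.

Set Implicit Arguments.
Unset Strict Implicit.
Unset Printing Implicit Defensive.

(** * Connectivity, spanning trees and bridges *)

Section Connectivity.
Variable V : finType.
Implicit Types (G H T : {set {set V}}) (A : {set V}) (r s t w : seq V).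
Implicit Types (x y z a b : V).

Definition connected_graph G : bool :=
  [forall x, forall y, connect (adj G) x y].

Lemma connected_graphP G :
  reflect (forall x y, connect (adj G) x y) (connected_graph G).
Proof.
apply: (iffP forallP) => [h x y|h x]; first by have /forallP := h x.
exact/forallP.
Qed.

Lemma adj_sym G : symmetric (adj G).
Proof. by move=> x y; rewrite /adj eq_sym setUC. Qed.

Lemma connect_adj_sym G : connect_sym (adj G).
Proof. exact/sym_connect_sym/adj_sym. Qed.

Lemma eq_set2 a b x y : [set a; b] = [set x; y] ->
  (a = x /\ b = y) \/ (a = y /\ b = x).
Proof.
move=> e.
have : a \in [set x; y] by rewrite -e set21.
have : b \in [set x; y] by rewrite -e set22.
have : x \in [set a; b] by rewrite e set21.
have : y \in [set a; b] by rewrite e set22.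
rewrite !inE => /orP[]/eqP-> /orP[]/eqP-> /orP[]/eqP h1 /orP[]/eqP h2; subst; auto.
Qed.

Lemma connect_cut (e : rel V) A x y :
  connect e x y -> x \in A -> y \notin A ->
  exists a b, [/\ a \in A, b \notin A & e a b].
Proof.
case/connectP=> s; elim: s x => [|z s IHs] x /=; first by move=> _ -> ->.
case/andP=> exz zs ylast xA yA; have [zA|zA] := boolP (z \in A).
  exact: IHs zs ylast zA yA.
by exists x, z.
Qed.

Lemma connect_adj_sub G H x y :
  G \subset H -> connect (adj G) x y -> connect (adj H) x y.
Proof.
move=> sGH; apply: connect_sub => a b /andP[ab abG].
by apply: connect1; rewrite /adj ab (subsetP sGH).
Qed.

(** Every use of the edge between [x] and [y] can be rerouted through [H]. This serves both for
    deleting an edge of a cycle and for exchanging an edge of a tree. *)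
Lemma connected_graph_replace G H x y :
  connected_graph G -> G :\ [set x; y] \subset H -> connect (adj H) x y ->
  connected_graph H.
Proof.
move=> /connected_graphP conG sGH xy; apply/connected_graphP => u v.
apply: connect_sub (conG u v) => a b /andP[ab abG].
have [e|ne] := eqVneq [set a; b] [set x; y]; last first.
  by apply: connect1; rewrite /adj ab (subsetP sGH) // !inE ne.
have [[-> ->]|[-> ->]] := eq_set2 e; first by [].
by rewrite connect_adj_sym.
Qed.

(** The rest of the cycle is a detour around its first edge; on only two nodes the detour would be
    that same edge. *)
Lemma connected_graph_del_cycle_edge G s :
  connected_graph G -> ucycle (adj G) s -> (2 < size s)%N ->
  exists2 e, e \in G & connected_graph (G :\ e).
Proof.
move=> conG /andP[]; case: s => [|x [|y [|z s]]] //= /andP[xy yzs].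
case/and3P=> xN yN _ _.
exists [set x; y]; first by case/andP: xy.
apply: (connected_graph_replace conG (subxx _)); rewrite connect_adj_sym.
have : path (adj G) y (rcons (z :: s) x) by exact: yzs.
rewrite rcons_path => /andP[ps lx]; apply: (@connect_trans _ _ (last y (z :: s))).
  apply/connectP; exists (z :: s) => //.
  have inN : {in predC1 x &, subrel (adj G) (adj (G :\ [set x; y]))}.
    move=> a b /= ax bx /andP[ab abG]; rewrite /adj ab !inE abG andbT /=.
    apply/eqP => /eq_set2[[ax' _]|[_ bx']].
      by rewrite ax' inE eqxx in ax.
    by rewrite bx' inE eqxx in bx.
  apply: (sub_in_path inN) ps.
  by apply/allP => v vs; apply: contraNneq xN => <-.
apply: connect1; case/andP: lx => lx lxG; rewrite /adj lx !inE lxG andbT /=.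
apply/eqP => /eq_set2[[l _]|[l _]].
  by rewrite /= l eqxx in lx.
by case/negP: yN; rewrite -l /= mem_last.
Qed.

(** An inclusion-minimal connected subgraph has no cycle, since an edge of a cycle could still be
    deleted. *)
Lemma spanning_tree_sub G : simple_graph G -> connected_graph G ->
  exists2 T, spanning_tree T & T \subset G.
Proof.
move=> sG cG; have [T /minsetP[cT minT] sTG] := minset_exists cG.
exists T => //; split.
- apply/forall_inP => e eT; exact: (forall_inP sG) (subsetP sTG _ eT).
- exact/connected_graphP.
- move=> s cs; rewrite ltnNge; apply/negP => s3.
  have [e eT cTe] := connected_graph_del_cycle_edge cT cs s3.
  by have := minT _ cTe (subD1set _ _); move/setP/(_ e); rewrite !inE eqxx eT.
Qed.

(** A repetition-free path avoiding the edge would close up with it to a cycle of [T]. Acyclicity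
    leaves at most two nodes, and then the path is the deleted edge itself. *)
Lemma spanning_tree_bridge T x y : spanning_tree T -> [set x; y] \in T ->
  ~~ connect (adj (T :\ [set x; y])) x y.
Proof.
case=> sT _ acycT xyT.
have xy : x != y by have := forall_inP sT _ xyT; rewrite cards2; case: (x == y).
apply/negP => /connectP[s0 ps0 ylast].
case/shortenP: ps0 ylast => s ps us _ ylast.
have : ucycle (adj T) (x :: s).
  rewrite /ucycle us andbT /= rcons_path -ylast; apply/andP; split.
    apply: sub_path ps => a b; rewrite /adj !inE => /andP[-> /andP[_ ->]] //.
  by rewrite adj_sym /adj xy.
move/acycT; case: s ps ylast {us} => [|z [|? ?]] //=.
  by move=> _ e; rewrite e eqxx in xy.
by rewrite /adj => /andP[/andP[_ xz] _] yz; rewrite yz !inE eqxx in xz.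
Qed.

(** A walk in [T] from [x] to [v] could leave the union of the two components only along an edge
    other than the deleted one, and such an edge stays within a component. *)
Lemma bridge_components T x y v : connected_graph T -> [set x; y] \in T ->
  v \in component (T :\ [set x; y]) x \/ v \in component (T :\ [set x; y]) y.
Proof.
move=> /connected_graphP conT xyT; apply/orP; rewrite -in_setU.
set A := _ :|: _; apply/negPn/negP => vA.
have xA : x \in A by rewrite !inE connect0.
have yA : y \in A by rewrite !inE connect0 orbT.
have [a [b [aA bA /andP[ab abT]]]] := connect_cut (conT x v) xA vA.
case/negP: bA; have [e|ne] := eqVneq [set a; b] [set x; y].
  by have [[_ ->]|[_ ->]] := eq_set2 e.
have abT' : connect (adj (T :\ [set x; y])) a b.
  by apply: connect1; rewrite /adj ab !inE ne.
move: aA; rewrite !inE => /orP[] h; apply/orP; [left|right];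
  exact: connect_trans h abT'.
Qed.

(** * Edges of paths and closed walks *)

Definition path_edges x s : seq {set V} := pairmap (fun a b => [set a; b]) x s.

Lemma path_edges_rcons x s y :
  path_edges x (rcons s y) = rcons (path_edges x s) [set last x s; y].
Proof. by rewrite -cats1 /path_edges pairmap_cat cats1. Qed.

Lemma walk_edges_cons x s : walk_edges (x :: s) = path_edges x (rcons s x).
Proof.
rewrite /walk_edges /path_edges rot1_cons; move: {2 4}x => y.
by elim: s x => //= z s IHs x; rewrite -IHs.
Qed.

Lemma walk_edges_rot i w : perm_eq (walk_edges (rot i w)) (walk_edges w).
Proof.
elim: i => [|i IHi]; first by rewrite rot0.
have [lti|lei] := ltnP i (size w); last by rewrite rot_oversize // ltnW.
rewrite rotS //; apply: perm_trans IHi; case: (rot i w) => [|x [|y s]] //.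
rewrite rot1_cons /= !walk_edges_cons path_edges_rcons last_rcons perm_rcons.
exact: perm_refl.
Qed.

Lemma walk_edges_map (f : V -> V) w :
  walk_edges (map f w) = [seq f @: e | e : {set V} <- walk_edges w].
Proof.
case: w => // x s; rewrite map_cons !walk_edges_cons -map_rcons.
move: (rcons s x) => t.
by elim: t x => //= y t IHt x; rewrite imsetU1 imset_set1 -IHt.
Qed.

Lemma path_edges_simple x s :
  uniq (x :: s) -> {in path_edges x s, forall e : {set V}, #|e| = 2}.
Proof.
elim: s x => //= y s IHs x /andP[xys uys] e; rewrite inE => /orP[/eqP->|].
  by rewrite cards2; move: xys; rewrite inE negb_or => /andP[->].
exact: IHs.
Qed.

Lemma walk_edges_simple w : uniq w -> (1 < size w)%N ->
  {in walk_edges w, forall e : {set V}, #|e| = 2}.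
Proof.
case: w => [|x [|y s]] // uw _ e.
rewrite walk_edges_cons path_edges_rcons mem_rcons inE => /orP[/eqP->|].
  rewrite cards2; case: eqP => // l; move: uw; rewrite cons_uniq => /andP[+ _].
  by rewrite -l /= mem_last.
exact: path_edges_simple.
Qed.

Lemma path_edges_connect G x s y : uniq (x :: s) ->
  {subset path_edges x s <= G} -> y \in x :: s -> connect (adj G) x y.
Proof.
elim: s x => [|z s IHs] x /=; first by rewrite inE => _ _ /eqP->.
case/andP=> xzs uzs sG; rewrite inE => /orP[/eqP->|yzs]; first exact: connect0.
apply: (@connect_trans _ _ z).
  apply: connect1; rewrite /adj sG ?mem_head // andbT.
  by move: xzs; rewrite inE negb_or => /andP[].
by apply: IHs => // e es; apply: sG; rewrite inE es orbT.
Qed.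

Lemma path_break (e : rel V) x s : ~~ path e x s ->
  exists s1 y s2, s = s1 ++ y :: s2 /\ ~~ e (last x s1) y.
Proof.
elim: s x => //= y s IHs x; rewrite negb_and.
have [exy /= /IHs[s1 [z [s2 [-> nz]]]]|nexy _] := boolP (e x y).
  by exists (y :: s1), z, s2.
by exists [::], y, s.
Qed.

(** The rotation makes the offending edge the closing one, so that dropping it leaves the path
    [x :: s]. *)
Lemma cycle_break (e : rel V) w : ~~ cycle e w ->
  exists i x s, rot i w = x :: s /\ ~~ e (last x s) x.
Proof.
case: w => //= x s /path_break[s1 [y [s2 [+ ne]]]].
case/lastP: s2 => [|s2 z].
  rewrite cats1 => /rcons_inj[-> xy]; rewrite -xy in ne.
  by exists 0%N, x, s1; rewrite rot0.
rewrite -rcons_cons -rcons_cat => /rcons_inj[-> _].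
exists (size (x :: s1)), y, (s2 ++ x :: s1).
by rewrite -cat_cons rot_size_cat last_cat.
Qed.

End Connectivity.

(** * Shortcutting under the triangle inequality, and weights of spanning trees *)

Section Costs.
Variables (R : realFieldType) (V : finType) (c : {set V} -> R).
Hypothesis c_metric : metric c.
Implicit Types (T : {set {set V}}) (A : {set V}) (r s t w : seq V).
Implicit Types (x y z a b : V).

(* The cost [c] is unconstrained on singletons, which [walk_edges] produces
   for repeated nodes; [loopless_cost] sets them to 0. *)
Definition loopless_cost (e : {set V}) : R := if #|e| == 2 then c e else 0.

Lemma metric_ge0 (e : {set V}) : #|e| = 2 -> 0 <= c e.
Proof.
by move/eqP/cards2P=> [x [y [xy ->]]]; case: c_metric => c_ge0 _; apply: c_ge0.
Qed.

Lemma loopless_cost_ge0 e : 0 <= loopless_cost e.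
Proof. by rewrite /loopless_cost; case: eqP => // /metric_ge0. Qed.

Lemma loopless_cost_triangle x y z :
  loopless_cost [set x; z] <= loopless_cost [set x; y] + loopless_cost [set y; z].
Proof.
have := loopless_cost_ge0 [set x; y]; have := loopless_cost_ge0 [set y; z].
rewrite /loopless_cost !cards2.
have [<-{y}|xy] := eqVneq x y; first by rewrite add0r.
have [<-{z}|yz] := eqVneq y z; first by rewrite xy addr0.
have [_|xz] := eqVneq x z; first by move=> *; apply: addr_ge0.
by move=> _ _; case: c_metric => _; apply.
Qed.

Definition path_weight x s : R := \sum_(e <- path_edges x s) loopless_cost e.

Lemma path_weight_cons x y s :
  path_weight x (y :: s) = loopless_cost [set x; y] + path_weight y s.
Proof. by rewrite /path_weight big_cons. Qed.

Lemma path_weight_skip x y z s :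
  path_weight x (rcons s z) <= loopless_cost [set x; y] + path_weight y (rcons s z).
Proof.
case: s => [|a s]; rewrite /= !path_weight_cons.
  by rewrite addrA lerD2r loopless_cost_triangle.
by rewrite addrA lerD2r loopless_cost_triangle.
Qed.

Lemma path_weight_subseq x s t y : subseq s t ->
  path_weight x (rcons s y) <= path_weight x (rcons t y).
Proof.
elim: t s x => [|b t IHt] [|a s] x //=.
  move=> _; rewrite [leRHS]path_weight_cons.
  apply: le_trans (path_weight_skip x b y [::]) _.
  by rewrite lerD2l; apply: IHt; rewrite sub0seq.
rewrite [leRHS]path_weight_cons; case: eqP => [->|_] st.
  by rewrite path_weight_cons lerD2l IHt.
by apply: le_trans (path_weight_skip x b y (a :: s)) _; rewrite lerD2l IHt.
Qed.

Lemma tour_weight_rot (c' : {set V} -> R) i w :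
  tour_weight c' (rot i w) = tour_weight c' w.
Proof. exact/perm_big/walk_edges_rot. Qed.

(** Rotating [w] to begin at the first node of [s] turns both closed walks into paths returning to
    that node, where the triangle inequality removes skipped nodes one at a time. *)
Lemma tour_weight_subseq s w : subseq s w ->
  tour_weight loopless_cost s <= tour_weight loopless_cost w.
Proof.
case: s => [_|x s].
  by rewrite /tour_weight big_nil sumr_ge0 // => e _; apply: loopless_cost_ge0.
move=> sw; have xw : x \in w by apply: mem_subseq sw _ _; rewrite mem_head.
have [w1 [w2 [-> sw2]]] : exists w1 w2, w = w1 ++ x :: w2 /\ subseq s w2.
  elim: w sw {xw} => //= y w IHw; case: eqP => [->|_] sw.
    by exists [::], w.
  by have [w1 [w2 [-> ?]]] := IHw sw; exists (y :: w1), w2.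
rewrite -(tour_weight_rot _ (size w1) (w1 ++ _)) rot_size_cat.
rewrite /tour_weight cat_cons !walk_edges_cons; apply: path_weight_subseq.
exact: subseq_trans sw2 (prefix_subseq _ _).
Qed.

Lemma tour_weight_loopless s : uniq s -> (1 < size s)%N ->
  tour_weight c s = tour_weight loopless_cost s.
Proof.
move=> us s1; rewrite /tour_weight; apply: eq_big_seq => e es.
by rewrite /loopless_cost (walk_edges_simple us s1 es).
Qed.

(** Repeated edges in [l] and edges outside [T] only raise the right side, because two-node sets
    have nonnegative cost. *)
Lemma tree_weight_le_sum T (l : seq {set V}) :
  {in l, forall e : {set V}, #|e| = 2} -> {subset T <= l} ->
  tree_weight c T <= \sum_(e <- l) c e.
Proof.
rewrite /tree_weight; elim: l T => [|f l IHl] T l2 sTl.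
  by rewrite big_nil big1 // => e /sTl.
have l2' : {in l, forall e : {set V}, #|e| = 2}.
  by move=> e el; apply: l2; rewrite inE el orbT.
have IH := IHl (T :\ f) l2'; rewrite big_cons.
have {}IH : \sum_(e in T :\ f) c e <= \sum_(e <- l) c e.
  by apply: IH => e; rewrite !inE => /andP[/negPf ne /sTl]; rewrite inE ne.
have [fT|fT] := boolP (f \in T).
  by rewrite (big_setD1 f fT) /= lerD2l.
have TD1 : T :\ f = T by apply/setDidPl; rewrite disjoint_sym disjoints1.
rewrite TD1 in IH.
by rewrite -[leLHS]add0r lerD ?metric_ge0 ?l2 ?mem_head.
Qed.

(** The edges of [l] contain a spanning tree. Upper bounds on the weight of [T] thus reduce to
    exhibiting a connected list of edges. *)
Lemma min_spanning_tree_le_sum T (l : seq {set V}) :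
  min_spanning_tree c T -> {in l, forall e : {set V}, #|e| = 2} ->
  connected_graph [set e in l] -> tree_weight c T <= \sum_(e <- l) c e.
Proof.
move=> [_ minT] l2 conl.
have simple_l : simple_graph [set e in l].
  by apply/forall_inP => e; rewrite inE => /l2->.
have [T' stT' sT'] := spanning_tree_sub simple_l conl.
apply: le_trans (minT _ stT') _; apply: tree_weight_le_sum => // e eT'.
by have := subsetP sT' _ eT'; rewrite inE.
Qed.

(** * The minimum spanning tree against an arbitrary pair of tours *)

Section Algorithm.
Variables (T : {set {set V}}) (xL xR : V).
Hypotheses (mstT : min_spanning_tree c T) (eT : [set xL; xR] \in T).
Hypothesis maxe : forall e, e \in T -> c e <= c [set xL; xR].

Local Notation f := [set xL; xR].
Local Notation VL := (component (T :\ f) xL).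

Lemma mst_connected : connected_graph T.
Proof. by apply/connected_graphP; case: mstT => -[]. Qed.

Lemma mst_edge_card2 e : e \in T -> #|e| = 2.
Proof. by case: mstT => -[/forall_inP sT _ _] _ /sT/eqP. Qed.

Lemma component_xR x : x \notin VL -> x \in component (T :\ f) xR.
Proof. by case: (bridge_components x mst_connected eT) => // ->. Qed.

Lemma xR_notin_component : xR \notin VL.
Proof. by rewrite inE; apply: spanning_tree_bridge => //; case: mstT. Qed.

(** Exchange argument: the edge between [x] and [y] rejoins the two components left by deleting [f],
    so by minimality it cannot be cheaper than [f]. *)
Lemma mst_cut x y : x \in VL -> y \notin VL -> c f <= c [set x; y].
Proof.
move=> xVL yVL; have yVR := component_xR yVL.
have xy : x != y by apply: contraNneq yVL => <-.
have := @min_spanning_tree_le_sum T ([set x; y] :: enum (T :\ f)) mstT.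
rewrite big_cons big_enum /tree_weight (big_setD1 f eT) /= lerD2r; apply.
  move=> e; rewrite inE mem_enum => /orP[/eqP->|]; first by rewrite cards2 xy.
  by rewrite inE => /andP[_ /mst_edge_card2].
have sub : T :\ f \subset [set e in [set x; y] :: enum (T :\ f)].
  by apply/subsetP => e eTf; rewrite in_set in_cons mem_enum eTf orbT.
apply: (connected_graph_replace mst_connected sub).
move: xVL yVR; rewrite !inE => /(connect_adj_sub sub) h1.
move=> /(connect_adj_sub sub); rewrite connect_adj_sym => h2.
apply: connect_trans h1 (connect_trans _ h2); apply: connect1.
by rewrite /adj xy in_set mem_head.
Qed.

(* Two disjoint spanning paths become connected after adding one edge of T,
   which costs at most [c f]. *)
Lemma mst_le_two_paths x s y t A :
  uniq (x :: s) -> uniq (y :: t) -> x :: s =i A -> y :: t =i ~: A ->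
  tree_weight c T <=
  c f + (\sum_(e <- path_edges x s) c e + \sum_(e <- path_edges y t) c e).
Proof.
move=> us ut sA tA.
have xA : x \in A by rewrite -sA mem_head.
have yA : y \notin A by rewrite -in_setC -tA mem_head.
have /connected_graphP/(_ x y)/connect_cut/(_ xA yA) := mst_connected.
case=> a [b [aA bA /andP[ab abT]]].
apply: le_trans (_ : \sum_(e <- [set a; b] :: path_edges x s ++ path_edges y t) c e <= _);
  last by rewrite big_cons big_cat /= lerD2r maxe.
apply: min_spanning_tree_le_sum => //.
  move=> e; rewrite inE mem_cat => /or3P[/eqP->|/path_edges_simple|/path_edges_simple].
  - by rewrite cards2 ab.
  - exact.
  - exact.
set G := [set e in _].
have cs z : z \in A -> connect (adj G) x z.
  move=> zA; apply: (@path_edges_connect _ _ _ s); rewrite ?sA // => e es.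
  by rewrite /G in_set in_cons mem_cat es orbT.
have ct z : z \notin A -> connect (adj G) y z.
  move=> zA; apply: (@path_edges_connect _ _ _ t); rewrite ?tA ?inE // => e es.
  by rewrite /G in_set in_cons mem_cat es !orbT.
have xy : connect (adj G) x y.
  apply: connect_trans (cs _ aA) _; rewrite connect_adj_sym.
  apply: connect_trans (ct _ bA) _; rewrite connect_adj_sym.
  by apply: connect1; rewrite /adj ab in_set mem_head.
have all_x z : connect (adj G) x z.
  have [/cs //|/ct] := boolP (z \in A); exact: connect_trans.
apply/connected_graphP => u v; apply: connect_trans (all_x v).
by rewrite connect_adj_sym.
Qed.

Lemma tour_on_uniq A s : tour_on A s -> uniq s /\ s =i A.
Proof.
move=> tA; split; first by rewrite (perm_uniq tA) enum_uniq.
by move=> x; rewrite (perm_mem tA) mem_enum.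
Qed.

(** Both tours lose their closing edge; that of [x :: s] is credited on the left, that of [b] is
    discarded as nonnegative. Rotating the first tour beforehand lets any of its edges be the
    credited one. *)
Lemma mst_le_tours_minus_edge A x s (b : seq V) :
  tour_on A (x :: s) -> tour_on (~: A) b -> (1 < size b)%N ->
  tree_weight c T + c [set last x s; x] <= c f + (tour_weight c (x :: s) + tour_weight c b).
Proof.
move=> /tour_on_uniq[us sA] /tour_on_uniq[]; case: b => // y t ut tA t1.
have := mst_le_two_paths us ut sA tA.
have : 0 <= c [set last y t; y].
  apply: metric_ge0; apply: (walk_edges_simple ut t1).
  by rewrite walk_edges_cons path_edges_rcons mem_rcons mem_head.
rewrite /tour_weight !walk_edges_cons !path_edges_rcons !big_rcons /=; lra.
Qed.

(** A relation, so that [cycle (uncut A) r] expresses that the tour [r] never crosses the cut. *)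
Definition uncut A : rel V := fun x y => (x \in A) == (y \in A).

(* A tour crossing the cut contains an edge of cost at least [c f], which pays
   for the edge of T joining the two tours. *)
Lemma mst_le_cut_tours A r (b : seq V) :
  tour_on A r -> tour_on (~: A) b -> (1 < size b)%N -> ~~ cycle (uncut VL) r ->
  tree_weight c T <= tour_weight c r + tour_weight c b.
Proof.
move=> rA bA b1 /cycle_break[i [x [s [rE cut]]]].
have rA' : tour_on A (x :: s) by rewrite /tour_on -rE perm_rot.
have := mst_le_tours_minus_edge rA' bA b1; rewrite -rE tour_weight_rot.
suff : c f <= c [set last x s; x] by lra.
move: cut; rewrite /uncut; case: (boolP (x \in VL)) => xL'.
  by rewrite eqb_id => ?; rewrite (setUC [set last x s]) mst_cut.
by rewrite eqbF_neg negbK => ?; rewrite mst_cut.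
Qed.

(** Here the closing edge of [r] is dropped only for its nonnegativity, so the cost of the joining
    edge remains as [c f]. *)
Lemma mst_del_le_tours A r (b : seq V) :
  tour_on A r -> tour_on (~: A) b -> (1 < size r)%N -> (1 < size b)%N ->
  tree_weight c T - c f <= tour_weight c r + tour_weight c b.
Proof.
case: r => // x s rA bA r1 b1; have := mst_le_tours_minus_edge rA bA b1.
have : 0 <= c [set last x s; x]; last by lra.
have [us _] := tour_on_uniq rA.
apply: metric_ge0; apply: (walk_edges_simple us r1).
by rewrite walk_edges_cons path_edges_rcons mem_rcons mem_head.
Qed.

Lemma cycle_uncut A r x y :
  cycle (uncut A) r -> x \in r -> y \in r -> (x \in A) = (y \in A).
Proof.
case: r => //= z s /order_path_min h.
have tr : transitive (uncut A) by move=> ? ? ? /eqP h1 /eqP h2; rewrite /uncut h1 h2.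
have {h}/allP h := h tr.
suff same u : u \in z :: s -> (z \in A) = (u \in A) by move=> /same<- /same<-.
by move=> us; apply/eqP/h; rewrite mem_rcons.
Qed.

(** * Weights of the tours returned by the algorithm *)

Variables (w C : seq V).
Hypotheses (eulw : doubled_euler_circuit T w) (scC : shortcut_tour w C).

(** The circuit uses each edge of [T] twice, hence the factor 2. Taking [phi] to be the identity
    gives the bound by all of [T]; collapsing one side of the cut gives the bound without [f]. *)
Lemma tour_weight_fold (phi : V -> V) s : subseq s (map phi w) ->
  uniq s -> (1 < size s)%N ->
  tour_weight c s <= 2 * \sum_(e in T) loopless_cost (phi @: e).
Proof.
move=> sw us s1; rewrite tour_weight_loopless //.
apply: le_trans (tour_weight_subseq sw) _.
rewrite /tour_weight walk_edges_map big_map (perm_big _ eulw) big_cat /=.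
by rewrite !big_enum /=; lra.
Qed.

Lemma filter_tour A (P : pred V) : P =1 mem A -> (1 < #|A|)%N ->
  [/\ tour_on A (filter P C), uniq (filter P C), (1 < size (filter P C))%N
    & subseq (filter P C) (filter P w)].
Proof.
move=> PA A1; case/andP: scC => tC sCw.
have [uC memC] := tour_on_uniq tC.
have uP : uniq (filter P C) by rewrite filter_uniq.
have tA : tour_on A (filter P C).
  apply: uniq_perm; rewrite ?enum_uniq // => x.
  by rewrite mem_filter memC mem_enum inE andbT PA.
split=> //; first by rewrite (perm_size tA) -cardE.
by rewrite subseq_filter filter_all (subseq_trans (filter_subseq _ _) sCw).
Qed.

Lemma filter_tour_weight A (P : pred V) : P =1 mem A -> (1 < #|A|)%N ->
  tour_weight c (filter P C) <= 2 * tree_weight c T.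
Proof.
move=> PA /(filter_tour PA)[_ uP P1 sP].
have sw : subseq (filter P C) (map id w).
  by rewrite map_id; apply: subseq_trans sP (filter_subseq _ _).
apply: le_trans (tour_weight_fold sw uP P1) _; rewrite ler_pM2l // /tree_weight.
apply: ler_sum => e eT'; rewrite imset_id /loopless_cost.
by rewrite (mst_edge_card2 eT').
Qed.

(* Collapsing the nodes outside A to the end [a] of [f] in A turns the Euler
   circuit into a closed walk that no longer pays for [f]. *)
Lemma filter_side_tour_weight A (P : pred V) a : P =1 mem A -> (1 < #|A|)%N ->
  (A = VL /\ a = xL) \/ (A = ~: VL /\ a = xR) ->
  tour_weight c (filter P C) <= 2 * (tree_weight c T - c f).
Proof.
move=> PA /(filter_tour PA)[_ uP P1 sP] side.
pose phi v := if v \in A then v else a.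
have sw : subseq (filter P C) (map phi w).
  apply: subseq_trans sP _; elim: w => //= v s IHs; rewrite PA /phi /=.
  case: ifP => vA /=; first by rewrite eqxx.
  exact: subseq_trans IHs (subseq_cons _ _).
apply: le_trans (tour_weight_fold sw uP P1) _; rewrite ler_pM2l //.
rewrite /tree_weight !(big_setD1 f eT) /=.
have xLV : xL \in VL by rewrite inE connect0.
have phif : loopless_cost (phi @: f) = 0.
  have -> : phi @: f = [set a; a].
    rewrite imsetU1 imset_set1 /phi.
    by case: side => -[-> ->]; rewrite ?in_setC (negPf xR_notin_component) xLV.
  by rewrite /loopless_cost cards2 eqxx.
rewrite phif add0r addrAC subrr add0r; apply: ler_sum => e eTf.
have e2 : #|e| = 2 by move: eTf; rewrite inE => /andP[_ /mst_edge_card2].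
have /cards2P[x [y [xy eE]]] : #|e| == 2 by rewrite e2.
(* No edge of [T] other than [f] crosses the cut, so [phi] either fixes both ends of [e] or
   collapses [e] to a point. *)
have xyVL : (x \in VL) = (y \in VL).
  have adjxy : connect (adj (T :\ f)) x y.
    by apply: connect1; rewrite /adj xy -eE.
  rewrite !inE; apply/idP/idP => h; first exact: connect_trans h adjxy.
  by apply: connect_trans h _; rewrite connect_adj_sym.
have xyA : (x \in A) = (y \in A) by case: side => -[-> _]; rewrite ?in_setC xyVL.
rewrite eE imsetU1 imset_set1 /phi xyA -eE; case: ifP => _.
  by rewrite -eE /loopless_cost e2.
rewrite /loopless_cost cards2 eqxx; exact: metric_ge0.
Qed.

End Algorithm.
End Costs.

(** * The approximation ratio *)

Theorem theorem6 (R : realFieldType) (n : nat) (V : finType)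
    (p q : 'I_n -> V) (c : {set V} -> R)
    (n_even : ~~ odd n) (pairs : pairing p q) (c_metric : metric c)
    (red : {set V}) (Cr Cb : seq V) (run : algorithm2 c p q red Cr Cb) :
  feasible p q red Cr Cb /\
  Num.max (tour_weight c Cb) (tour_weight c Cr) <= 4 * opt_mm c p q.
Proof.
case: run => T xL xR {}red w C mstT eT maxe col sides eulw scC.
(* The node [xL] rules out [n = 0] and parity rules out [n = 1]; hence all tours have at least two
   nodes and no loops. *)
have n1 : (1 < n)%N.
  have [g _ _] := pairs; have [i _] := g xL.
  by case: (n) n_even i => [|[|]] // _ [].
have [cr cb] := card_coloring pairs col.
have Pr : (fun x => x \in red) =1 mem red by [].
have Pb : (fun x => x \notin red) =1 mem (~: red) by move=> x /=; rewrite in_setC.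
have r1 : (1 < #|red|)%N by rewrite cr.
have b1 : (1 < #|~: red|)%N by rewrite cb.
split.
  rewrite /feasible col.
  have [-> _ _ _] := filter_tour scC Pr r1.
  by have [-> _ _ _] := filter_tour scC Pb b1.
have [[red' [r [b [/and3P[col' tr tb] <-]]]] _] := opt_mmP c pairs.
have [cr' cb'] := card_coloring pairs col'.
have sr : (1 < size r)%N by rewrite (perm_size tr) -cardE cr'.
have sb : (1 < size b)%N by rewrite (perm_size tb) -cardE cb'.
have sum_le : tour_weight c r + tour_weight c b <= 2 * mm_cost c r b.
  have : tour_weight c r <= mm_cost c r b by rewrite le_max lexx.
  have : tour_weight c b <= mm_cost c r b by rewrite le_max lexx orbT.
  lra.
pose f := [set xL; xR]; pose VL := component (T :\ f) xL.
(* The factor 4 is 2 from doubling the tree times 2 from bounding a sum of two tours by their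
   maximum. *)
have heavy : tree_weight c T <= tour_weight c r + tour_weight c b ->
    Num.max (tour_weight c [seq x <- C | x \notin red])
            (tour_weight c [seq x <- C | x \in red]) <= 4 * mm_cost c r b.
  move=> leT; rewrite ge_max.
  have := filter_tour_weight c_metric mstT eulw scC Pr r1.
  have := filter_tour_weight c_metric mstT eulw scC Pb b1.
  by move=> h1 h2; apply/andP; split; lra.
have [ucr|/(mst_le_cut_tours c_metric mstT eT maxe tr tb sb)] :=
  boolP (cycle (uncut VL) r); last exact: heavy.
(* If only [b] crosses the cut, the two tours exchange roles. *)
have [ucb|cutb] := boolP (cycle (uncut VL) b); last first.
  apply: heavy; rewrite addrC.
  apply: (mst_le_cut_tours c_metric mstT eT maxe tb _ sr cutb).
  by rewrite setCK.
have [_ memr] := tour_on_uniq tr; have [_ memb] := tour_on_uniq tb.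
have same x y : (x \in red') = (y \in red') -> (x \in VL) = (y \in VL).
  have [xr /esym yr|xr /esym/negbT yr] := boolP (x \in red').
    by apply: (cycle_uncut ucr); rewrite memr.
  by apply: (cycle_uncut ucb); rewrite memb in_setC.
have xLV : xL \in VL by rewrite inE connect0.
have xRV : xR \notin VL by exact: xR_notin_component mstT eT.
(* If two nodes of different optimal colors lay on one side, [same] would put every node there,
   although [f] has an end on each side. *)
have opp x y : (x \in red') != (y \in red') -> (x \in VL) != (y \in VL).
  move=> xy; apply/eqP => exy.
  have all_x z : (z \in VL) = (x \in VL).
    have [|h] := eqVneq (z \in red') (x \in red'); first exact: same.
    rewrite exy; apply: same; move: xy h.
    by case: (x \in red'); case: (y \in red'); case: (z \in red').
  by move: xRV; rewrite all_x -(all_x xL) xLV.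
(* By [opp] the cut splits every pair, so the coloring rule leaves no free choice. *)
have redE : red = ~: VL.
  have pairE i : (p i \in red) = (p i \notin VL) /\ (q i \in red) = (q i \notin VL).
    have := opp _ _ (forallP col' i).
    case: (boolP (p i \in VL)) => pV; case: (boolP (q i \in VL)) => qV // _.
      by have [/negPf-> ->] := sides i _ _ erefl pV (component_xR mstT eT qV).
    by have [/negPf-> ->] := sides i _ _ (setUC _ _) qV (component_xR mstT eT pV).
  apply/setP => x; rewrite in_setC; have [g _ gK] := pairs.
  by rewrite -(gK x); case: (g x) => i [] /=; case: (pairE i).
have del := mst_del_le_tours c_metric mstT maxe tr tb sr sb.
have wr : tour_weight c [seq x <- C | x \in red] <= 2 * (tree_weight c T - c f).
  apply: (filter_side_tour_weight c_metric mstT eT eulw scC Pr r1 (a := xR)).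
  by right.
have wb : tour_weight c [seq x <- C | x \notin red] <= 2 * (tree_weight c T - c f).
  apply: (filter_side_tour_weight c_metric mstT eT eulw scC Pb b1 (a := xL)).
  by left; rewrite redE setCK.
by rewrite ge_max; apply/andP; split; lra.
Qed.
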